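(* Let $H$ be a Hopf algebra over a field $k$ with coradical filtration $H_0\subseteq H_1\subseteq\cdots$. If there exists a non-negative integer $n$ with $H_n=H$, then $H$ is co-Frobenius.
   Context: $k$ is a field. The coradical $H_0$ is the sum of all simple subcoalgebras of $H$, and $H_{n+1}=\Delta^{-1}(H_n\otimes H+H\otimes H_0)$. A left integral on $H$ is a linear map $\int\in H^*$ such that $\alpha\int=\alpha(1)\int$ for all $\alpha\in H^*$ (convolution product). A Hopf algebra is called co-Frobenius if there is a non-zero left integral on it. *)

(* Defs.v *)
From HB Require Import structures.
From mathcomp Require Import all_boot all_algebra.
From mathcomp Require Import boolp classical_sets.
From mathcomp Require Import freeg.

Set Implicit Arguments.
Unset Strict Implicit.
Unset Printing Implicit Defensive.

Import GRing.Theory.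
Local Open Scope classical_set_scope.
Local Open Scope quotient_scope.
Local Open Scope ring_scope.

Reserved Notation "u \ox v" (at level 40, left associativity).

(** ** Linear spans *)

Section LinearSpan.
Variables (k : fieldType) (V : lmodType k).
Implicit Types (S T : set V).

Definition lspan S : set V :=
  [set x | exists n (a : 'I_n -> k) (v : 'I_n -> V),
     (forall i, S (v i)) /\ x = \sum_(i < n) a i *: v i].

Definition subspace S : Prop := GRing.submod_closed [in S].

Lemma subspaceP S :
  subspace S <-> S 0 /\ forall a u v, S u -> S v -> S (a *: u + v).
Proof.
rewrite /subspace /GRing.submod_closed /GRing.linear_closed; split.
  case=> S0 SD; split; first by move: S0; rewrite !inE.
  by move=> a u v Su Sv; move: (SD a u v); rewrite !inE; apply.
case=> S0 SD; split; first by rewrite !inE.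
by move=> a u v; rewrite !inE; apply: SD.
Qed.

Lemma lspan_subspace S : subspace (lspan S).
Proof.
apply/subspaceP; split.
  by exists 0, (fun=> 0), (fun=> 0); rewrite big_ord0; split=> // -[].
move=> c _ _ [m [a [u [Su ->]]]] [n [b [v [Sv ->]]]].
exists (m + n)%N, (fun i => match split i with
    | inl j => c * a j | inr j => b j end),
  (fun i => match split i with inl j => u j | inr j => v j end).
split=> [i|]; first by case: (split i).
rewrite big_split_ord scaler_sumr; congr (_ + _); apply: eq_bigr => i _ /=.
  by rewrite scalerA -[lshift n i]/(unsplit (inl i)) unsplitK.
by rewrite -[rshift m i]/(unsplit (inr i)) unsplitK.
Qed.

Lemma sub_lspan S : S `<=` lspan S.
Proof.
by move=> x Sx; exists 1%N, (fun=> 1), (fun=> x); rewrite big_ord1 scale1r.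
Qed.

Lemma lspan_min S T : subspace T -> S `<=` T -> lspan S `<=` T.
Proof.
move=> /subspaceP[T0 TD] sST _ [n [a [v [Sv ->]]]].
elim/big_rec: _ => // i x _ Tx; exact/TD/Tx/sST.
Qed.

End LinearSpan.

(** ** Tensor products of vector spaces *)

Lemma freegZU (k : fieldType) (K : choiceType) (a : k) (x : K) :
  << a *g x >> = a *: << x >>.
Proof.
apply/eqP/freeg_eqP => y.
by rewrite -[a *: _]/(fgscale a _) coeff_fgscale !coeffU mul1r.
Qed.

Section FreeLift.
Variables (k : fieldType) (K : choiceType) (W : lmodType k) (f : K -> W).

HB.instance Definition _ := GRing.isZmodMorphism.Build {freeg K / k} W
  (fglift f) (lift_is_additive f).

Fact fglift_scalable : scalable (fglift f : {freeg K / k} -> W).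
Proof.
move=> c D; rewrite -[c *: D]/(fgscale c D) -{2}[D]freeg_sumE /fgscale.
rewrite !raddf_sum; apply: eq_bigr => x _ /=.
by rewrite !liftU scalerA.
Qed.

HB.instance Definition _ := GRing.isScalable.Build k {freeg K / k} W *:%R
  (fglift f) fglift_scalable.

End FreeLift.

Section TensorProduct.
Variables (k : fieldType) (U V : lmodType k).

Local Notation free := {freeg (U * V)%type / k}.

Definition tensor_rel : set free :=
  [set x | exists a u u' v,
     x = << (a *: u + u', v) >> - (a *: << (u, v) >> + << (u', v) >>)]
  `|` [set x | exists a u v v',
     x = << (u, a *: v + v') >> - (a *: << (u, v) >> + << (u, v') >>)].

Definition tensor_ker : {pred free} := [in lspan tensor_rel].

HB.instance Definition _ := GRing.isSubmodClosed.Build k free tensor_ker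
  (GRing.submod_closed_semi (lspan_subspace tensor_rel)).

Definition tensor : Type := Quotient.quot tensor_ker.

HB.instance Definition _ := GRing.Zmodule.on tensor.
HB.instance Definition _ := Quotient.on tensor.

Definition pi_tensor (x : free) : tensor := \pi_(Quotient.quot tensor_ker) x.

Lemma pi_tensorP x y : pi_tensor x = pi_tensor y <-> lspan tensor_rel (x - y).
Proof.
split=> [/eqP|xy]; first by rewrite -Quotient.idealrBE inE.
by apply/eqP; rewrite -Quotient.idealrBE inE.
Qed.

Lemma pi_tensor_ind (P : tensor -> Prop) :
  (forall x, P (pi_tensor x)) -> forall t, P t.
Proof. by move=> Ppi t; rewrite -[t]reprK; apply: Ppi. Qed.

Lemma pi_tensorB : zmod_morphism pi_tensor.
Proof. by move=> x y; rewrite /pi_tensor !piE. Qed.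

HB.instance Definition _ := GRing.isZmodMorphism.Build free tensor pi_tensor
  pi_tensorB.

Definition tensor_scale (a : k) (t : tensor) : tensor :=
  pi_tensor (a *: repr t).

Lemma pi_tensorZ a x : tensor_scale a (pi_tensor x) = pi_tensor (a *: x).
Proof.
apply/pi_tensorP; rewrite -scalerBr.
have /subspaceP[S0 SD] := lspan_subspace tensor_rel.
rewrite -[X in lspan _ X]addr0; apply: SD S0.
by apply/pi_tensorP; rewrite /pi_tensor reprK.
Qed.

Fact tensor_scaleA a b t :
  tensor_scale a (tensor_scale b t) = tensor_scale (a * b) t.
Proof. by elim/pi_tensor_ind: t => x; rewrite !pi_tensorZ scalerA. Qed.

Fact tensor_scale1 : left_id 1 tensor_scale.
Proof. by elim/pi_tensor_ind => x; rewrite !pi_tensorZ scale1r. Qed.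

Fact tensor_scaleDr : right_distributive tensor_scale +%R.
Proof.
move=> a; elim/pi_tensor_ind => x; elim/pi_tensor_ind => y.
by rewrite -raddfD !pi_tensorZ -raddfD scalerDr.
Qed.

Fact tensor_scaleDl t : {morph tensor_scale^~ t : a b / a + b}.
Proof.
by elim/pi_tensor_ind: t => x a b; rewrite !pi_tensorZ -raddfD scalerDl.
Qed.

HB.instance Definition _ := GRing.Zmodule_isLmodule.Build k tensor
  tensor_scaleA tensor_scale1 tensor_scaleDr tensor_scaleDl.

Fact pi_tensor_scalable : scalable pi_tensor.
Proof. by move=> a x; rewrite -pi_tensorZ. Qed.

HB.instance Definition _ := GRing.isScalable.Build k free tensor *:%R pi_tensor
  pi_tensor_scalable.

Definition tens (u : U) (v : V) : tensor := pi_tensor << (u, v) >>.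

Fact tens_bilinear : bilinear_for *:%R *:%R tens.
Proof.
split=> [v|u] a x y; rewrite /tens -linearZ -raddfD; apply/pi_tensorP;
  apply: sub_lspan; [left | right].
- by exists a, x, y, v.
- by exists a, u, x, y.
Qed.

HB.instance Definition _ := bilinear_isBilinear.Build k U V tensor *:%R *:%R
  tens tens_bilinear.

Lemma tensorE (t : tensor) :
  exists n (u : 'I_n -> U) (v : 'I_n -> V), t = \sum_(i < n) tens (u i) (v i).
Proof.
elim/pi_tensor_ind: t => x; rewrite -[x]freeg_sumE raddf_sum.
elim: (dom x) => [|[u v] s [n [f [g IHs]]]].
  by exists 0, (fun=> 0), (fun=> 0); rewrite big_nil big_ord0.
pose c := coeff (u, v) x.
exists n.+1, (fun i => if unlift ord0 i is Some j then f j else c *: u),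
  (fun i => if unlift ord0 i is Some j then g j else v).
rewrite big_cons IHs big_ord_recl unlift_none; congr (_ + _); last first.
  by apply: eq_bigr => i _; rewrite liftK.
by rewrite linearZl_LR (freegZU c) /= linearZ.
Qed.

Lemma tensor_ind (P : tensor -> Prop) :
  P 0 -> (forall u v t, P t -> P (tens u v + t)) -> forall t, P t.
Proof.
move=> P0 PD t; have [n [u [v ->]]] := tensorE t.
by elim/big_rec: _ => // i x _; apply: PD.
Qed.

End TensorProduct.

Arguments tens {k U V} u v.
Notation "u \ox v" := (tens u v) : ring_scope.

Section UniversalProperty.
Variables (k : fieldType) (U V W : lmodType k).

Section Lift.
Variable f : {bilinear U -> V -> W}.

Definition tensor_lift (t : tensor U V) : W :=
  fglift (fun p => f p.1 p.2) (repr t : {freeg (U * V)%type / k}).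

Lemma tensor_lift_pi x :
  tensor_lift (pi_tensor x) = fglift (fun p => f p.1 p.2) x.
Proof.
pose g : {linear {freeg (U * V)%type / k} -> W} := fglift (fun p => f p.1 p.2).
rewrite /tensor_lift -!/(g _); apply/eqP; rewrite -subr_eq0 -raddfB; apply/eqP.
have: lspan (@tensor_rel k U V) (repr (pi_tensor x) - x).
  by apply/pi_tensorP; rewrite {1}/pi_tensor reprK.
apply: (@lspan_min _ _ _ [set y | g y = 0]).
  apply/subspaceP; split=> [|a y z gy gz]; first exact: raddf0.
  by rewrite /mkset (linearP g) [g y]gy [g z]gz scaler0 addr0.
move=> _ [[a [u [u' [v ->]]]]|[a [u [v [v' ->]]]]] /=.
  rewrite (linearB g) (linearD g) (linearZ_LR g) /= !liftU !scale1r /=.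
  by rewrite linearPl subrr.
rewrite (linearB g) (linearD g) (linearZ_LR g) /= !liftU !scale1r /=.
by rewrite linearPr subrr.
Qed.

Fact tensor_lift_linear : linear tensor_lift.
Proof.
move=> a; elim/pi_tensor_ind => x; elim/pi_tensor_ind => y.
by rewrite -linearP !tensor_lift_pi linearP.
Qed.

HB.instance Definition _ := GRing.isLinear.Build k (tensor U V) W *:%R
  tensor_lift tensor_lift_linear.

Lemma tensor_liftE u v : tensor_lift (u \ox v) = f u v.
Proof. by rewrite tensor_lift_pi liftU scale1r. Qed.

End Lift.

Lemma tensor_ext (g h : {linear tensor U V -> W}) :
  (forall u v, g (u \ox v) = h (u \ox v)) -> g =1 h.
Proof.
move=> gh; elim/tensor_ind => [|u v t IHt]; first by rewrite !linear0.
by rewrite !linearD gh IHt.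
Qed.

End UniversalProperty.

Section TensorMap.
Variables (k : fieldType) (U V U' V' : lmodType k).
Variables (f : {linear U -> U'}) (g : {linear V -> V'}).

Definition tensor_map_fun (u : U) (v : V) : tensor U' V' := f u \ox g v.

Fact tensor_map_fun_bilinear : bilinear_for *:%R *:%R tensor_map_fun.
Proof.
by split=> [v|u] a x y; rewrite /tensor_map_fun linearP ?linearPl ?linearPr.
Qed.

HB.instance Definition _ := bilinear_isBilinear.Build k U V (tensor U' V')
  *:%R *:%R tensor_map_fun tensor_map_fun_bilinear.

Definition tensor_map : {linear tensor U V -> tensor U' V'} :=
  tensor_lift tensor_map_fun.

Lemma tensor_mapE u v : tensor_map (u \ox v) = f u \ox g v.
Proof. exact: tensor_liftE. Qed.

End TensorMap.

Section TensorAssoc.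
Variables (k : fieldType) (U V W : lmodType k).

Section FixedLast.
Variable w : W.

Definition tensor_assoc_inner (u : U) (v : V) : tensor U (tensor V W) :=
  u \ox (v \ox w).

Fact tensor_assoc_inner_bilinear : bilinear_for *:%R *:%R tensor_assoc_inner.
Proof.
by split=> [v|u] a x y; rewrite /tensor_assoc_inner ?linearPl // linearPr.
Qed.

HB.instance Definition _ := bilinear_isBilinear.Build k U V
  (tensor U (tensor V W)) *:%R *:%R tensor_assoc_inner
  tensor_assoc_inner_bilinear.

End FixedLast.

Definition tensor_assoc_fun (t : tensor U V) (w : W) : tensor U (tensor V W) :=
  tensor_lift (tensor_assoc_inner w) t.

Fact tensor_assoc_fun_bilinear : bilinear_for *:%R *:%R tensor_assoc_fun.
Proof.
split=> [w|t] a x y; first exact: linearP.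
rewrite /tensor_assoc_fun; elim/tensor_ind: t => [|u v t IHt].
  by rewrite !linear0 /= ?scaler0 addr0.
rewrite !linearD /= IHt !tensor_liftE /= /tensor_assoc_inner !linearPr.
by rewrite /= ?scalerDr addrACA.
Qed.

HB.instance Definition _ := bilinear_isBilinear.Build k (tensor U V) W
  (tensor U (tensor V W)) *:%R *:%R tensor_assoc_fun tensor_assoc_fun_bilinear.

Definition tensor_assoc :
    {linear tensor (tensor U V) W -> tensor U (tensor V W)} :=
  tensor_lift tensor_assoc_fun.

Lemma tensor_assocE u v w :
  tensor_assoc ((u \ox v) \ox w) = u \ox (v \ox w).
Proof. by rewrite /tensor_assoc /= tensor_liftE /= /tensor_assoc_fun tensor_liftE. Qed.

End TensorAssoc.

(** ** The tensor product of two algebras *)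

Section TensorAlgebra.
Variables (k : fieldType) (A B : algType k).

Section RightFactor.
Variables (a' : A) (b' : B).

Definition tensor_mul_pure (a : A) (b : B) : tensor A B := (a * a') \ox (b * b').

Fact tensor_mul_pure_bilinear : bilinear_for *:%R *:%R tensor_mul_pure.
Proof.
split=> [b|a] c x y; rewrite /tensor_mul_pure mulrDl -scalerAl.
  by rewrite linearPl.
by rewrite linearPr.
Qed.

HB.instance Definition _ := bilinear_isBilinear.Build k A B (tensor A B)
  *:%R *:%R tensor_mul_pure tensor_mul_pure_bilinear.

End RightFactor.

Section LeftFactor.
Variable t : tensor A B.

Definition tensor_mul_left (a' : A) (b' : B) : tensor A B :=
  tensor_lift (tensor_mul_pure a' b') t.

Fact tensor_mul_left_bilinear : bilinear_for *:%R *:%R tensor_mul_left.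
Proof.
rewrite /tensor_mul_left; split=> [b'|a'] c x y;
  elim/tensor_ind: t => [|a b t' IHt];
  rewrite ?linear0 /= ?scaler0 ?addr0 // !linearD /= IHt !tensor_liftE /=;
  rewrite /tensor_mul_pure mulrDr -scalerAr ?linearPl ?linearPr;
  by rewrite /= ?scalerDr addrACA.
Qed.

HB.instance Definition _ := bilinear_isBilinear.Build k A B (tensor A B)
  *:%R *:%R tensor_mul_left tensor_mul_left_bilinear.

End LeftFactor.

Definition tensor_mul (t t' : tensor A B) : tensor A B :=
  tensor_lift (tensor_mul_left t) t'.

Definition tensor_one : tensor A B := 1 \ox 1.

Lemma tensor_mulE a b a' b' :
  tensor_mul (a \ox b) (a' \ox b') = (a * a') \ox (b * b').
Proof. by rewrite /tensor_mul tensor_liftE /= /tensor_mul_left tensor_liftE. Qed.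

Fact tensor_mulDr : right_distributive tensor_mul +%R.
Proof. by move=> t t1 t2; rewrite /tensor_mul linearD. Qed.

Fact tensor_mulDl : left_distributive tensor_mul +%R.
Proof.
move=> t1 t2; elim/tensor_ind => [|a b t IHt].
  by rewrite /tensor_mul !linear0 addr0.
rewrite !tensor_mulDr IHt addrACA; congr (_ + _).
by rewrite /tensor_mul !tensor_liftE /= /tensor_mul_left linearD.
Qed.

Fact tensor_mul0t : left_zero 0 tensor_mul.
Proof. by move=> t; apply: (addIr (tensor_mul 0 t)); rewrite -tensor_mulDl !add0r. Qed.

Fact tensor_mult0 : right_zero 0 tensor_mul.
Proof. by move=> t; rewrite /tensor_mul linear0. Qed.

Fact tensor_mul1t : left_id tensor_one tensor_mul.
Proof.
elim/tensor_ind => [|a b t IHt]; first exact: tensor_mult0.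
by rewrite tensor_mulDr IHt tensor_mulE !mul1r.
Qed.

Fact tensor_mult1 : right_id tensor_one tensor_mul.
Proof.
elim/tensor_ind => [|a b t IHt]; first exact: tensor_mul0t.
by rewrite tensor_mulDl IHt tensor_mulE !mulr1.
Qed.

Fact tensor_mulA : associative tensor_mul.
Proof.
move=> x y z; elim/tensor_ind: x => [|a1 b1 x IHx]; first by rewrite !tensor_mul0t.
rewrite !tensor_mulDl IHx; congr (_ + _) => {x IHx}.
elim/tensor_ind: y => [|a2 b2 y IHy]; first by rewrite !(tensor_mul0t, tensor_mult0).
rewrite !(tensor_mulDl, tensor_mulDr) IHy; congr (_ + _) => {y IHy}.
elim/tensor_ind: z => [|a3 b3 z IHz]; first by rewrite !tensor_mult0.
by rewrite !tensor_mulDr IHz !tensor_mulE !mulrA.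
Qed.

HB.instance Definition _ := GRing.Zmodule_isPzRing.Build (tensor A B)
  tensor_mulA tensor_mul1t tensor_mult1 tensor_mulDl tensor_mulDr.

End TensorAlgebra.

Section Multiplication.
Variables (k : fieldType) (A : algType k).

Definition mul_fun (a b : A) : A := a * b.

Fact mul_fun_bilinear : bilinear_for *:%R *:%R mul_fun.
Proof.
split=> [b|a] c x y; rewrite /mul_fun /= ?mulrDl ?mulrDr.
  by rewrite scalerAl.
by rewrite scalerAr.
Qed.

HB.instance Definition _ := bilinear_isBilinear.Build k A A A *:%R *:%R
  mul_fun mul_fun_bilinear.

Definition mulT : {linear tensor A A -> A} := tensor_lift mul_fun.

Lemma mulTE a b : mulT (a \ox b) = a * b.
Proof. exact: tensor_liftE. Qed.

End Multiplication.

(** ** Coalgebras, bialgebras and Hopf algebras *)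

HB.mixin Record isCoalgebra (k : fieldType) C of GRing.Lmodule k C := {
  comul : {linear C -> tensor C C};
  counit : {linear C -> k^o};
  comulA : forall x,
    tensor_assoc C C C (tensor_map comul idfun (comul x)) =
    tensor_map idfun comul (comul x);
  counitl : forall x, tensor_map counit idfun (comul x) = (1 : k^o) \ox x;
  counitr : forall x, tensor_map idfun counit (comul x) = x \ox (1 : k^o)
}.

#[short(type="coalgType")]
HB.structure Definition Coalgebra (k : fieldType) :=
  {C of GRing.Lmodule k C & isCoalgebra k C}.

HB.mixin Record isBialgebra (k : fieldType) H
    of GRing.Algebra k H & Coalgebra k H := {
  comul_monoid_morphism : monoid_morphism (comul : H -> tensor H H);
  counit_monoid_morphism : monoid_morphism (counit : H -> k)
}.

#[short(type="bialgType")]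
HB.structure Definition Bialgebra (k : fieldType) :=
  {H of GRing.Algebra k H & Coalgebra k H & isBialgebra k H}.

HB.mixin Record hasAntipode (k : fieldType) H of Bialgebra k H := {
  antipode : {linear H -> H};
  antipodel : forall x : H,
    mulT H (tensor_map antipode idfun (comul x)) = counit x *: 1;
  antipoder : forall x : H,
    mulT H (tensor_map idfun antipode (comul x)) = counit x *: 1
}.

#[short(type="hopfAlgType")]
HB.structure Definition HopfAlgebra (k : fieldType) :=
  {H of Bialgebra k H & hasAntipode k H}.

(** ** The coradical filtration *)

Section CoradicalFiltration.
Variables (k : fieldType) (C : coalgType k).
Implicit Types (D E : set C) (n : nat).

(* Over a field the canonical map from tensor D E to tensor C C is injective, so the
   tensor product of two subspaces is identified with its image. *)
Definition tensor_set D E : set (tensor C C) :=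
  lspan [set x \ox y | x in D & y in E].

Definition subcoalgebra D : Prop :=
  subspace D /\ comul @` D `<=` tensor_set D D.

Definition simple_subcoalgebra D : Prop :=
  [/\ subcoalgebra D, D <> [set 0] &
      forall E, subcoalgebra E -> E `<=` D -> E = [set 0] \/ E = D].

Definition coradical : set C :=
  lspan (\bigcup_(D in simple_subcoalgebra) D).

Fixpoint coradical_filtration n : set C :=
  if n is m.+1 then
    comul @^-1` [set x + y | x in tensor_set (coradical_filtration m) setT
                           & y in tensor_set setT coradical]
  else coradical.

End CoradicalFiltration.

(** ** Integrals *)

Section Integrals.
Variables (k : fieldType) (H : hopfAlgType k).

Definition convolution (f g : {linear H -> k^o}) : {linear H -> k^o} :=
  mulT k^o \o tensor_map f g \o comul.

Definition left_integral (t : {linear H -> k^o}) : Prop :=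
  forall f : {linear H -> k^o}, convolution f t =1 f 1 \*: t.

Definition co_Frobenius : Prop :=
  exists2 t : {linear H -> k^o}, left_integral t & ~ (t =1 \0).

End Integrals.

(* Main.v *)
From HB Require Import structures.
Require Import Defs.
From mathcomp Require Import all_boot all_algebra.
From mathcomp Require Import boolp classical_sets.

Set Implicit Arguments.
Unset Strict Implicit.
Unset Printing Implicit Defensive.

Import GRing.Theory.
Local Open Scope classical_set_scope.
Local Open Scope ring_scope.

(** Write [f ~> x = x1 f(x2)] and [x <~ f = f(x1) x2] for the two actions of a
    functional [f] on a coalgebra ([lhit f x] and [rhit f x]).  A functional [t]
    is a left integral exactly when [t ~> h = t(h) 1] for all [h], that is, when
    [t] is a morphism of left comodules from [H] to the trivial comodule [k].
    Such a morphism is obtained from a finite coradical filtration in three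
    steps.

    Nilpotency gives a functional with values in the coradical.  The functionals
    that vanish on [H_0] form an ideal [J] of the dual algebra, and a product of
    [n + 1] of them vanishes on [H_n].  When [H_n = H] the ideal is nilpotent, so
    there is a nonzero functional [F] with [f * F = 0] for all [f] in [J].  This
    says that [F ~> h] lies in [H_0] for all [h]
    ([coradical_valued_functional]).

    Semisimplicity of the coradical gives a functional of finite rank.  Some
    value [F ~> x] has a nonzero component in a simple subcoalgebra [D], and [D]
    meets the sum [O] of the other simple subcoalgebras trivially.  A functional
    [g] equal to the counit on [D] and to zero on [O] projects [H_0 = D + O] to
    [D] by [y |-> g ~> y].  Hence the functional [g * F] is nonzero and
    [h |-> (g * F) ~> h] takes its values in [D], which is finite-dimensional
    ([finite_rank_functional]).

    The antipode turns finite rank into an integral.  If [h |-> F ~> h] has a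
    finite-dimensional image [V], it is a nonzero morphism of left comodules from
    [H] to [V].  Tensoring it with the dual comodule of [V] and composing with
    the evaluation map [V (x) V^* -> k] gives a nonzero comodule morphism from
    [H (x) V^*] to [k].  The comodule [H (x) V^*] is isomorphic to a direct sum of
    copies of [H], on one of which the morphism to [k] is not zero: this is the
    integral.  In coordinates, if [F ~> h = sum_i phi_i(h) e_i] and the [c_ij] are
    the matrix coefficients of [V] in the basis [e_i], then the restrictions to the
    copies of [H] are the functionals [h |-> sum_i phi_i(h S(S(c_ij)))]
    ([comatrix_integral], [finite_rank_co_Frobenius]). *)

(** * Subspaces and linear functionals *)

Section LinearAlgebra.
Variables (k : fieldType) (V : lmodType k).
Implicit Types (A S : set V) (f g : {linear V -> k^o}).

Lemma linear_functional (f : V -> k^o) : linear f ->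
  exists g : {linear V -> k^o}, g =1 f.
Proof.
move=> lf; pose m := GRing.isLinear.Build k V k^o *:%R f lf.
pose g : {linear V -> k^o} := HB.pack f m.
by exists g.
Qed.

Lemma functionalZ f a x : f (a *: x) = a * f x.
Proof. exact: linearZ. Qed.

Lemma functionalP f a x y : f (a *: x + y) = a * f x + f y.
Proof. exact: linearP. Qed.

Section Subspace.
Variable A : set V.
Hypothesis sA : subspace A.

Lemma subspace0 : A 0. Proof. by have /subspaceP[] := sA. Qed.

Lemma subspaceMD a u v : A u -> A v -> A (a *: u + v).
Proof. by have /subspaceP[_] := sA; apply. Qed.

Lemma subspaceD u v : A u -> A v -> A (u + v).
Proof. by rewrite -[u in A (u + _)]scale1r; apply: subspaceMD. Qed.

Lemma subspaceZ a u : A u -> A (a *: u).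
Proof.
by move=> Au; rewrite -[_ *: _]addr0; apply: subspaceMD => //; apply: subspace0.
Qed.

Lemma subspaceB u v : A u -> A v -> A (u - v).
Proof. by move=> Au Av; rewrite -scaleN1r addrC; apply: subspaceMD. Qed.

Lemma subspace_sum (I : Type) (r : seq I) (P : pred I) (F : I -> V) :
  (forall i, P i -> A (F i)) -> A (\sum_(i <- r | P i) F i).
Proof. exact: (big_ind A subspace0 subspaceD). Qed.

End Subspace.

Lemma subspace_set0 : subspace [set (0 : V)].
Proof. by apply/subspaceP; split=> // a u v /= -> ->; rewrite scaler0 addr0. Qed.

Lemma subspaceI A S : subspace A -> subspace S -> subspace (A `&` S).
Proof.
move=> sA sS; apply/subspaceP; split; first by split; apply: subspace0.
by move=> a u v [Au Su] [Av Sv]; split; apply: subspaceMD.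
Qed.

Lemma subspace_add A S : subspace A -> subspace S ->
  subspace [set x + y | x in A & y in S].
Proof.
move=> sA sS; apply/subspaceP; split.
  by exists 0; [apply: subspace0 | exists 0; [apply: subspace0 | rewrite addr0]].
move=> a _ _ [u Au [v Sv <-]] [u' Au' [v' Sv' <-]].
exists (a *: u + u'); first exact: subspaceMD.
exists (a *: v + v'); first exact: subspaceMD.
by rewrite scalerDr addrACA.
Qed.

Lemma subspace_ker (W : lmodType k) (h : {linear V -> W}) :
  subspace [set x | h x = 0].
Proof.
apply/subspaceP; split=> [|a u v /= hu hv]; first exact: linear0.
by rewrite linearP hu hv scaler0 addr0.
Qed.

(** By Zorn's lemma there is a subspace [M] that contains [A] and is maximal among
    those avoiding [w].  Maximality makes [M] a hyperplane complementary to the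
    line of [w], and the functional is the coordinate along [w]. *)
Lemma separation A w : subspace A -> ~ A w ->
  exists2 g : {linear V -> k^o}, (forall x, A x -> g x = 0) & g w = 1.
Proof.
move=> sA Aw.
(* The union with [A] makes the empty chain harmless: its union is the empty set,
   which is not a subspace. *)
pose P B := subspace (A `|` B) /\ ~ (A `|` B) w.
have [|B [[sB Bw] maxB]] := @Zorn_bigcup _ P.
  move=> F FP totF; split; last first.
    by case=> // -[X /FP[_ nX] Xw]; apply: nX; right.
  apply/subspaceP; split; first by left; exact: (subspace0 sA).
  have Fsub X : F X -> A `|` X `<=` A `|` \bigcup_(Y in F) Y.
    by move=> FX x [Ax|Xx]; [left|right; exists X].
  have FMD X a u v : F X -> (A `|` X) u -> (A `|` X) v ->
      (A `|` \bigcup_(Y in F) Y) (a *: u + v).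
    by move=> FX Xu Xv; apply: (Fsub X) => //; apply: subspaceMD => //; case: (FP _ FX).
  move=> a u v [Au|[X FX Xu]] [Av|[Y FY Yv]].
  - by left; apply: subspaceMD.
  - by apply: (FMD Y) => //; [left|right].
  - by apply: (FMD X) => //; [right|left].
  - have [XY|YX] := totF _ _ FX FY.
      by apply: (FMD Y) => //; right => //; apply: XY.
    by apply: (FMD X) => //; right => //; apply: YX.
set M := A `|` B in sB Bw.
have decomp u : exists a, M (u - a *: w).
  have [Mu|Mu] := pselect (M u); first by exists 0; rewrite scale0r subr0.
  pose C := [set x + y | x in M & y in [set c *: u | c in setT]].
  have sL : subspace [set c *: u | c in setT].
    apply/subspaceP; split; first by exists 0; rewrite ?scale0r.
    by move=> a _ _ [c _ <-] [c' _ <-]; exists (a * c + c'); rewrite ?scalerDl ?scalerA.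
  have sC : subspace C by exact: subspace_add.
  have L0 := subspace0 sL.
  have MC : M `<=` C by move=> x Mx; exists x => //; exists (0 : V) => //; exact: addr0.
  have Cu : C u.
    exists 0; first exact: subspace0.
    by exists u; [exists 1; rewrite ?scale1r | rewrite add0r].
  have CE : A `|` C = C.
    by apply/setUidPr => x Ax; apply: MC; left.
  have : ~ P C.
    apply: maxB; split=> [x Bx|CB]; first by apply: MC; right.
    by apply: Mu; right; apply: CB.
  rewrite /P CE => nPC.
  have [x Mx [_ [c _ <-] xw]] : C w by apply: contrapT => Cw; apply: nPC.
  have c0 : c != 0.
    by apply/eqP => c0; apply: Bw; rewrite -xw c0 scale0r addr0.
  exists c^-1; rewrite -xw scalerDr scalerA mulVf // scale1r opprD addrCA subrr addr0.
  by rewrite -scaleN1r; apply: subspaceZ => //; apply: subspaceZ.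
have [g Mg] := choice decomp.
have uniqg u a : M (u - a *: w) -> g u = a.
  move=> Ma; apply/eqP; rewrite -subr_eq0; apply: contrapT => /negP ne0.
  apply: Bw; rewrite -[w]scale1r -(mulVf ne0) -scalerA; apply: subspaceZ => //.
  have -> : (g u - a) *: w = (u - a *: w) - (u - g u *: w).
    by rewrite scalerBl opprB [RHS]addrC addrA subrK.
  exact: subspaceB.
have [|f fg] := @linear_functional g.
  move=> a u v; apply: uniqg.
  have -> : a *: u + v - (a *: (g u : k^o) + g v) *: w
     = a *: (u - g u *: w) + (v - g v *: w).
    by rewrite scalerDl scalerBr scalerA opprD addrACA.
  exact: subspaceMD.
exists f => [x Ax|]; rewrite fg; apply: uniqg.
  by rewrite scale0r subr0; left.
by rewrite scale1r subrr; apply: subspace0.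
Qed.

Lemma separation0 w : w <> 0 -> exists f : {linear V -> k^o}, f w = 1.
Proof.
by move=> w0; have [f _ fw] := @separation [set 0] w subspace_set0 w0; exists f.
Qed.

Lemma eq_functionals u v : (forall f : {linear V -> k^o}, f u = f v) -> u = v.
Proof.
move=> fuv; apply: contrapT => /eqP; rewrite -subr_eq0 => /eqP /separation0[f].
by rewrite linearB fuv subrr => /esym/eqP; rewrite oner_eq0.
Qed.

Section LspanSeq.
Variable s : seq V.

Lemma lspan_seq_coord x : lspan [set` s] x ->
  exists a : 'I_(size s) -> k, x = \sum_i a i *: s`_i.
Proof.
pose T := [set x | exists a : 'I_(size s) -> k, x = \sum_i a i *: s`_i].
have sT : subspace T.
  apply/subspaceP; split.
    by exists (fun=> 0); rewrite big1 // => i _; rewrite scale0r.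
  move=> a _ _ [b ->] [c ->]; exists (fun i => a * b i + c i).
  by rewrite scaler_sumr -big_split; apply: eq_bigr => i _; rewrite scalerDl scalerA.
apply: (lspan_min sT) => y /= ys.
have ltys : (index y s < size s)%N by rewrite index_mem.
exists (fun i => (i == Ordinal ltys)%:R).
rewrite (bigD1 (Ordinal ltys)) //= eqxx scale1r nth_index // big1 ?addr0 //.
by move=> i /negPf ->; rewrite scale0r.
Qed.

(** The coordinates of the [e i] on [s] and the values of the [f j] on [s] are two
    matrices whose product is the identity of size [n]. *)
Lemma biorthogonal_size n (e : 'I_n -> V) (f : 'I_n -> {linear V -> k^o}) :
  (forall i, lspan [set` s] (e i)) -> (forall i j, f i (e j) = (i == j)%:R) ->
  (n <= size s)%N.
Proof.
move=> es fe; have [a ea] := choice (fun i => lspan_seq_coord (es i)).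
pose A : 'M[k]_(n, size s) := \matrix_(i, j) a i j.
pose B : 'M[k]_(size s, n) := \matrix_(i, j) (f j s`_i : k).
apply: (@mulmx1_min _ _ _ A B); apply/matrixP => i j.
rewrite !mxE eq_sym -fe ea linear_sum.
by apply: eq_bigr => l _; rewrite !mxE linearZ.
Qed.

End LspanSeq.

(** A biorthogonal family of maximal length in [S] is a basis of [S]: otherwise
    the remainder of some vector of [S] is nonzero, hence not in [A], and a
    functional that separates it from [A] extends the family.  The subspace [A] is
    there so that the coordinates on [S] can be prescribed to vanish on a
    subspace that meets [S] trivially. *)
Lemma dual_basis A S (s : seq V) : subspace A -> subspace S ->
    (forall x, A x -> S x -> x = 0) -> S `<=` lspan [set` s] ->
  exists n (e : 'I_n -> V) (f : 'I_n -> {linear V -> k^o}),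
  [/\ forall i, S (e i), forall i j, f i (e j) = (i == j)%:R,
      forall i x, A x -> f i x = 0 & forall x, S x -> x = \sum_i f i x *: e i].
Proof.
move=> sA sS AS0 Ss.
pose P n := exists (e : 'I_n -> V) (f : 'I_n -> {linear V -> k^o}),
  [/\ forall i, S (e i), forall i j, f i (e j) = (i == j)%:R &
      forall i x, A x -> f i x = 0].
have P0 : exists n, `[< P n >].
  by exists 0%N; apply/asboolP; exists (fun=> 0), (fun=> \0); split=> -[].
have Ple n : `[< P n >] -> (n <= size s)%N.
  move=> /asboolP[e [f [Se fe _]]].
  by apply: (biorthogonal_size (e := e)) fe => i; apply: Ss.
case: (ex_maxnP P0 Ple) => n /asboolP[e [f [Se fe fA]]] maxn.
exists n, e, f; split=> // x Sx; apply: contrapT => ne.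
pose w := x - \sum_i f i x *: e i.
have Sw : S w.
  by apply: subspaceB => //; apply: subspace_sum => // i _; apply: subspaceZ.
have fw i : f i w = 0.
  rewrite linearB linear_sum (bigD1 i) //= functionalZ fe eqxx mulr1 big1 => [|j ji].
    by rewrite addr0 subrr.
  by rewrite functionalZ fe eq_sym (negPf ji) mulr0.
have w0 : ~ A w.
  move=> Aw; apply: ne; apply/eqP; rewrite -subr_eq0; apply/eqP; exact: AS0.
have [g gA gw] := separation sA w0.
have [|h hE] := @linear_functional (fun x => g x - \sum_i g (e i) * (f i x : k)).
  move=> a u v; rewrite linearP /= [_ *: (_ - _)]mulrBr -addrACA -opprD; congr (_ - _).
  rewrite mulr_sumr -big_split; apply: eq_bigr => i _ /=.
  by rewrite linearP mulrDr mulrCA.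
suff : (n.+1 <= n)%N by rewrite ltnn.
apply: maxn; apply/asboolP.
exists (fun i => if unlift ord0 i is Some j then e j else w).
exists (fun i => if unlift ord0 i is Some j then f j else h); split.
- by move=> i; case: unliftP.
- move=> i j; case: (unliftP ord0 i) => [i'|] ->; case: (unliftP ord0 j) => [j'|] ->.
  + by rewrite fe (inj_eq lift_inj).
  + by rewrite fw.
  + rewrite hE (bigD1 j') //= fe eqxx mulr1 big1 => [|l lj].
      by rewrite addr0 subrr.
    by rewrite fe (negPf lj) mulr0.
  + by rewrite eqxx hE gw big1 ?subr0 // => l _; rewrite fw mulr0.
- move=> i y Ay; case: unliftP => [j|] _; first exact: fA.
  by rewrite hE gA // big1 ?subr0 // => l _; rewrite fA // mulr0.
Qed.

End LinearAlgebra.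

Lemma subspace_preim (k : fieldType) (U V : lmodType k) (h : {linear U -> V})
    (D : set V) :
  subspace D -> subspace (h @^-1` D).
Proof.
move=> sD; apply/subspaceP; split=> [|a u v hu hv]; rewrite /preimage /=.
  by rewrite linear0; apply: subspace0.
by rewrite linearP; apply: subspaceMD.
Qed.

(** * Contracting a tensor by a functional *)

Section Contraction.
Variables (k : fieldType) (U V : lmodType k).

Section ContractR.
Variable f : {linear V -> k^o}.

Definition contractr_pure (u : U) (v : V) : U := (f v : k) *: u.

Fact contractr_pure_bilinear : bilinear_for *:%R *:%R contractr_pure.
Proof.
split=> [v|u] a x y; rewrite /contractr_pure.
  by rewrite scalerDr scalerA mulrC -scalerA.
by rewrite functionalP scalerDl -scalerA.
Qed.

HB.instance Definition _ := bilinear_isBilinear.Build k U V U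
  *:%R *:%R contractr_pure contractr_pure_bilinear.

Definition contractr : {linear tensor U V -> U} := tensor_lift contractr_pure.

Lemma contractrE u v : contractr (u \ox v) = (f v : k) *: u.
Proof. exact: tensor_liftE. Qed.

End ContractR.

Section ContractL.
Variable f : {linear U -> k^o}.

Definition contractl_pure (u : U) (v : V) : V := (f u : k) *: v.

Fact contractl_pure_bilinear : bilinear_for *:%R *:%R contractl_pure.
Proof.
split=> [v|u] a x y; rewrite /contractl_pure.
  by rewrite functionalP scalerDl -scalerA.
by rewrite scalerDr scalerA mulrC -scalerA.
Qed.

HB.instance Definition _ := bilinear_isBilinear.Build k U V V
  *:%R *:%R contractl_pure contractl_pure_bilinear.

Definition contractl : {linear tensor U V -> V} := tensor_lift contractl_pure.

Lemma contractlE u v : contractl (u \ox v) = (f u : k) *: v.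
Proof. exact: tensor_liftE. Qed.

End ContractL.

Lemma contract_exchange (f : {linear U -> k^o}) (g : {linear V -> k^o}) t :
  f (contractr g t) = g (contractl f t).
Proof.
elim/tensor_ind: t => [|u v t IHt]; first by rewrite !linear0.
by rewrite !linearD IHt contractrE contractlE !functionalZ mulrC.
Qed.

Lemma tens_sumZl (I : Type) (r : seq I) (a : I -> k) (x : I -> U) (v : V) :
  (\sum_(i <- r) a i *: x i) \ox v = \sum_(i <- r) x i \ox (a i *: v).
Proof.
rewrite -[_ \ox v]/(applyr (@tens k U V) v _) linear_sum; apply: eq_bigr => i _ /=.
by rewrite linearZl_LR linearZr_LR.
Qed.

Lemma tens_sumZr (I : Type) (r : seq I) (a : I -> k) (u : U) (y : I -> V) :
  u \ox (\sum_(i <- r) a i *: y i) = \sum_(i <- r) (a i *: u) \ox y i.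
Proof.
rewrite linear_sumr; apply: eq_bigr => i _.
by rewrite linearZl_LR linearZr_LR.
Qed.

Lemma tens_suml (I : Type) (r : seq I) (x : I -> U) (v : V) :
  (\sum_(i <- r) x i) \ox v = \sum_(i <- r) x i \ox v.
Proof. by rewrite -[_ \ox v]/(applyr (@tens k U V) v _) linear_sum. Qed.

Lemma tens_sumr (I : Type) (r : seq I) (u : U) (y : I -> V) :
  u \ox (\sum_(i <- r) y i) = \sum_(i <- r) u \ox y i.
Proof. exact: linear_sumr. Qed.

Lemma tensor_basisr t : exists n (f : 'I_n -> {linear V -> k^o}) (e : 'I_n -> V),
  t = \sum_i contractr (f i) t \ox e i.
Proof.
have [m [u [v tE]]] := tensorE t.
have [n [e [f [_ _ _ fK]]]] :=
  dual_basis (subspace_set0 _) (lspan_subspace [set` codom v])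
    (fun x x0 _ => x0) (fun _ => id).
have expand i : u i \ox v i = \sum_j ((f j (v i) : k) *: u i) \ox e j.
  by rewrite -tens_sumZr -fK //; apply: sub_lspan; rewrite /= codom_f.
exists n, f, e; rewrite {1}tE (eq_bigr _ (fun i _ => expand i)) exchange_big.
apply: eq_bigr => j _ /=.
rewrite -tens_suml tE linear_sum; congr (_ \ox _).
by apply: eq_bigr => i _; rewrite contractrE.
Qed.

(** Choosing a basis of the span of the right legs of a tensor, the left legs
    become contractions of the tensor; choosing then a basis of the span of
    those left legs, the right legs become contractions as well. *)
Lemma tensor_set_contract D E (t : tensor U V) : subspace D ->
    (forall f, D (contractr f t)) -> (forall f, E (contractl f t)) ->
  lspan [set x \ox y | x in D & y in E] t.
Proof.
move=> sD tD tE; have [m [f [v tv]]] := tensor_basisr t.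
pose u i := contractr (f i) t.
have [n [e [g [De _ _ gK]]]] :=
  dual_basis (subspace_set0 _) (lspan_subspace [set` codom u])
    (fun x x0 _ => x0) (fun _ => id).
have {}De i : D (e i).
  apply: lspan_min (De i) => // _ /codomP[j ->]; exact: tD.
have -> : t = \sum_i e i \ox contractl (g i) t.
  have expand i : u i \ox v i = \sum_j e j \ox ((g j (u i) : k) *: v i).
    by rewrite -tens_sumZl -gK //; apply: sub_lspan; rewrite /= codom_f.
  rewrite {1}tv (eq_bigr _ (fun i _ => expand i)) exchange_big.
  apply: eq_bigr => j _ /=.
  rewrite -tens_sumr tv linear_sum; congr (_ \ox _).
  by apply: eq_bigr => i _; rewrite contractlE.
apply: subspace_sum => [|i _]; first exact: lspan_subspace.
by apply: sub_lspan; exists (e i) => //; exists (contractl (g i) t).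
Qed.

Lemma tensor_set_ker (W : lmodType k) (h : {linear tensor U V -> W}) D E t :
    (forall x y, D x -> E y -> h (x \ox y) = 0) ->
  lspan [set x \ox y | x in D & y in E] t -> h t = 0.
Proof.
move=> hDE; apply: (lspan_min (subspace_ker h)) => _ [x Dx [y Ey <-]].
exact: hDE.
Qed.

End Contraction.

Arguments contractr {k U V} f.
Arguments contractl {k U V} f.

Section ContractionFunctoriality.
Variables (k : fieldType) (U V W : lmodType k).

(** Contracting an outer leg of a threefold tensor does not depend on the
    bracketing; this is how coassociativity enters. *)
Lemma contractl_assoc (f : {linear U -> k^o}) (t : tensor (tensor U V) W) :
  contractl f (tensor_assoc U V W t) = tensor_map (contractl f) idfun t.
Proof.
elim/tensor_ind: t => [|s w t IHt]; first by rewrite !linear0.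
rewrite !linearD {}IHt; congr (_ + _); rewrite tensor_mapE.
elim/tensor_ind: s => [|u v s IHs].
  by rewrite linear0l !linear0 linear0l.
rewrite linearDl !linearD IHs linearDl; congr (_ + _).
by rewrite tensor_assocE !contractlE linearZl_LR.
Qed.

Lemma contractr_assoc (f : {linear W -> k^o}) (t : tensor (tensor U V) W) :
  tensor_map idfun (contractr f) (tensor_assoc U V W t) = contractr f t.
Proof.
elim/tensor_ind: t => [|s w t IHt]; first by rewrite !linear0.
rewrite !linearD {}IHt; congr (_ + _); rewrite contractrE.
elim/tensor_ind: s => [|u v s IHs].
  by rewrite linear0l !linear0 ?scaler0.
rewrite linearDl !linearD IHs; congr (_ + _).
by rewrite tensor_assocE tensor_mapE contractrE linearZr_LR.
Qed.

End ContractionFunctoriality.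

Section ContractionMap.
Variables (k : fieldType) (U V U' V' : lmodType k).
Implicit Type t : tensor U V.

Lemma contractr_map (h : {linear U -> U'}) (g : {linear V -> V'})
    (f : {linear V' -> k^o}) t :
  contractr f (tensor_map h g t) = h (contractr (f \o g) t).
Proof.
elim/tensor_ind: t => [|u v t IHt]; first by rewrite !linear0.
by rewrite !linearD IHt tensor_mapE !contractrE linearZ.
Qed.

Lemma contractl_map (h : {linear U -> U'}) (g : {linear V -> V'})
    (f : {linear U' -> k^o}) t :
  contractl f (tensor_map h g t) = g (contractl (f \o h) t).
Proof.
elim/tensor_ind: t => [|u v t IHt]; first by rewrite !linear0.
by rewrite !linearD IHt tensor_mapE !contractlE linearZ.
Qed.

Lemma tensor_map_idr (V'' : lmodType k) (h : {linear V' -> V''})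
    (g : {linear V -> V'}) t :
  tensor_map idfun h (tensor_map idfun g t) = tensor_map idfun (h \o g) t.
Proof.
elim/tensor_ind: t => [|u v t IHt]; first by rewrite !linear0.
by rewrite !linearD IHt !tensor_mapE.
Qed.

Lemma tensor_map_idl (U'' : lmodType k) (h : {linear U' -> U''})
    (g : {linear U -> U'}) t :
  tensor_map h idfun (tensor_map g idfun t) = tensor_map (h \o g) idfun t.
Proof.
elim/tensor_ind: t => [|u v t IHt]; first by rewrite !linear0.
by rewrite !linearD IHt !tensor_mapE.
Qed.

Lemma tensor_map_coord n (f : 'I_n -> {linear V -> k^o}) (e : 'I_n -> V')
    (g : {linear V -> V'}) t :
    (forall v, g v = \sum_i (f i v : k) *: e i) ->
  tensor_map idfun g t = \sum_i contractr (f i) t \ox e i.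
Proof.
move=> gE; elim/tensor_ind: t => [|u v t IHt].
  by rewrite linear0 big1 // => i _; rewrite linear0 linear0l.
rewrite linearD IHt tensor_mapE gE tens_sumZr -big_split; apply: eq_bigr => i _ /=.
by rewrite linearD linearDl contractrE.
Qed.

Lemma eq_contractr (f g : {linear V -> k^o}) t :
  f =1 g -> contractr f t = contractr g t.
Proof.
move=> fg; elim/tensor_ind: t => [|u v t IHt]; first by rewrite !linear0.
by rewrite !linearD IHt !contractrE fg.
Qed.

Lemma eq_contractl (f g : {linear U -> k^o}) t :
  f =1 g -> contractl f t = contractl g t.
Proof.
move=> fg; elim/tensor_ind: t => [|u v t IHt]; first by rewrite !linear0.
by rewrite !linearD IHt !contractlE fg.
Qed.

End ContractionMap.

(** * The two actions of functionals on a coalgebra *)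

Section Hits.
Variables (k : fieldType) (C : coalgType k).
Implicit Types (f g : {linear C -> k^o}) (x : C).

Definition lhit f : {linear C -> C} := contractr f \o comul.
Definition rhit f : {linear C -> C} := contractl f \o comul.

(** By coassociativity the two hit actions are comodule endomorphisms: [lhit g] acts
    on the right leg of the comultiplication, [rhit g] on the left leg. *)
Lemma comul_lhit g x : comul (lhit g x) = tensor_map idfun (lhit g) (comul x).
Proof.
rewrite -(tensor_map_idr (contractr g) comul) -comulA contractr_assoc contractr_map /=.
by congr (comul _); apply: eq_contractr.
Qed.

Lemma comul_rhit g x : comul (rhit g x) = tensor_map (rhit g) idfun (comul x).
Proof.
rewrite -(tensor_map_idl (contractl g) comul) -contractl_assoc comulA contractl_map /=.
by congr (comul _); apply: eq_contractl.
Qed.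

Lemma lhit_rhit f g x : f (lhit g x) = g (rhit f x).
Proof. exact: contract_exchange. Qed.

Lemma hitC f g x : lhit f (rhit g x) = rhit g (lhit f x).
Proof.
rewrite [LHS]/= comul_rhit contractr_map; congr (rhit g _); exact: eq_contractr.
Qed.

(** The functional [f \o lhit g] is the convolution product of [f] and [g], so
    [lhit] is a left action of the dual algebra. *)
Lemma lhit_comp f g x : lhit f (lhit g x) = lhit (f \o lhit g) x.
Proof. by rewrite [LHS]/= comul_lhit contractr_map. Qed.

Lemma rhit_comp f g x : rhit f (rhit g x) = rhit (f \o rhit g) x.
Proof. by rewrite [LHS]/= comul_rhit contractl_map. Qed.

Lemma lhit_counit x : lhit counit x = x.
Proof.
have := congr1 (contractr (idfun : {linear k^o -> k^o})) (counitr x).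
rewrite contractr_map contractrE scale1r /= => xE.
by rewrite -[RHS]xE; exact: eq_contractr.
Qed.

Lemma rhit_counit x : rhit counit x = x.
Proof.
have := congr1 (contractl (idfun : {linear k^o -> k^o})) (counitl x).
rewrite contractl_map contractlE scale1r /= => xE.
by rewrite -[RHS]xE; exact: eq_contractl.
Qed.

End Hits.

(** * Simple subcoalgebras *)

Section SimpleSubcoalgebras.
Variables (k : fieldType) (C : coalgType k).
Implicit Types (D E A : set C) (f g : {linear C -> k^o}) (x : C).

(** Subcoalgebras are the subspaces stable under both actions of the dual algebra,
    since membership of a tensor in [tensor_set D D] is detected by its
    contractions.  With this description intersections, sums and generated
    subcoalgebras involve no tensors. *)
Lemma subcoalgebraP D : subcoalgebra D <->
  [/\ subspace D, forall f x, D x -> D (lhit f x) & forall f x, D x -> D (rhit f x)].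
Proof.
split=> [[sD DD]|[sD Dl Dr]]; split=> //.
- move=> f x Dx; apply: (lspan_min (subspace_preim (contractr f) sD)) (DD _ _).
    by move=> _ [u Du [v Dv <-]]; rewrite /preimage /= contractrE; apply: subspaceZ.
  by exists x.
- move=> f x Dx; apply: (lspan_min (subspace_preim (contractl f) sD)) (DD _ _).
    by move=> _ [u Du [v Dv <-]]; rewrite /preimage /= contractlE; apply: subspaceZ.
  by exists x.
- move=> _ [x Dx <-]; apply: tensor_set_contract => // f; [exact: Dl | exact: Dr].
Qed.

Lemma subcoalgebraI D E : subcoalgebra D -> subcoalgebra E -> subcoalgebra (D `&` E).
Proof.
move=> /subcoalgebraP[sD Dl Dr] /subcoalgebraP[sE El Er]; apply/subcoalgebraP.
split; first exact: subspaceI.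
  by move=> f x [Dx Ex]; split; [apply: Dl | apply: El].
by move=> f x [Dx Ex]; split; [apply: Dr | apply: Er].
Qed.

Lemma subcoalgebra_lspan (P : set (set C)) :
  (forall D, P D -> subcoalgebra D) -> subcoalgebra (lspan (\bigcup_(D in P) D)).
Proof.
move=> PD; have sP := lspan_subspace (\bigcup_(D in P) D).
apply/subcoalgebraP; split=> // f; apply: (lspan_min (subspace_preim _ sP));
  move=> x [D DP Dx]; apply: sub_lspan; exists D => //;
  have /subcoalgebraP[_ Dl Dr] := PD _ DP;
  [exact: Dl | exact: Dr].
Qed.

Lemma subcoalgebraD D E : subcoalgebra D -> subcoalgebra E ->
  subcoalgebra [set x + y | x in D & y in E].
Proof.
move=> /subcoalgebraP[sD Dl Dr] /subcoalgebraP[sE El Er]; apply/subcoalgebraP.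
split; first exact: subspace_add.
  move=> f _ [x Dx [y Ey <-]]; exists (lhit f x); first exact: Dl.
  by exists (lhit f y); [exact: El | rewrite linearD].
move=> f _ [x Dx [y Ey <-]]; exists (rhit f x); first exact: Dr.
by exists (rhit f y); [exact: Er | rewrite linearD].
Qed.

(** The action of [f] on a subcoalgebra depends only on the restriction of [f]. *)
Lemma lhit_local D f g : subcoalgebra D -> (forall x, D x -> f x = g x) ->
  forall x, D x -> lhit f x = lhit g x.
Proof.
move=> /subcoalgebraP[_ _ Dr] fg x Dx; apply: eq_functionals => h.
by rewrite !lhit_rhit fg //; apply: Dr.
Qed.

Lemma lhit_finite x : exists s : seq C, forall f, lspan [set` s] (lhit f x).
Proof.
have [n [u [v xE]]] := tensorE (comul x); exists (codom u) => f.
rewrite /= xE linear_sum; apply: subspace_sum => [|i _]; first exact: lspan_subspace.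
rewrite contractrE; apply: subspaceZ; first exact: lspan_subspace.
by apply: sub_lspan; rewrite /= codom_f.
Qed.

Lemma rhit_finite x : exists s : seq C, forall f, lspan [set` s] (rhit f x).
Proof.
have [n [u [v xE]]] := tensorE (comul x); exists (codom v) => f.
rewrite /= xE linear_sum; apply: subspace_sum => [|i _]; first exact: lspan_subspace.
rewrite contractlE; apply: subspaceZ; first exact: lspan_subspace.
by apply: sub_lspan; rewrite /= codom_f.
Qed.

Lemma simple_subcoalgebra_sub D E : simple_subcoalgebra D -> subcoalgebra E ->
  (exists2 x, D x /\ E x & x <> 0) -> D `<=` E.
Proof.
move=> [cD D0 Dmin] cE [x [Dx Ex] x0].
have [|DE0|DE] := Dmin (D `&` E) (subcoalgebraI cD cE); first by move=> y [].
  by have : (D `&` E) x by []; rewrite DE0.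
by rewrite -DE => y [].
Qed.

Lemma simple_subcoalgebra_eq D E : simple_subcoalgebra D -> simple_subcoalgebra E ->
  D `<=` E -> D = E.
Proof. by move=> [cD D0 _] [_ _ Emin] /(Emin _ cD)[]. Qed.

Lemma simple_neq0 D : simple_subcoalgebra D -> exists2 x, D x & x <> 0.
Proof.
move=> [[sD _] D0 _]; apply: contrapT => nD; apply: D0; apply/seteqP; split=> x.
  by move=> Dx; apply: contrapT => x0; apply: nD; exists x.
by move->; apply: subspace0.
Qed.

(** A simple subcoalgebra is generated by any nonzero [d] in it, so it is spanned
    by the [rhit f (lhit g d)].  These stay in the span of the finitely many middle
    legs of [d1 (x) d2 (x) d3]. *)
Lemma simple_finite D : simple_subcoalgebra D ->
  exists s : seq C, D `<=` lspan [set` s].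
Proof.
move=> simD; have [d Dd d0] := simple_neq0 simD.
pose E := lspan [set rhit f (lhit g d) | f in setT & g in setT].
have sE : subspace E by apply: lspan_subspace.
have cE : subcoalgebra E.
  apply/subcoalgebraP; split=> // h; apply: (lspan_min (subspace_preim _ sE)) =>
    _ [f _ [g _ <-]]; apply: sub_lspan.
    by exists f => //; exists (h \o lhit g) => //; rewrite -lhit_comp hitC.
  by exists (h \o rhit f) => //; exists g => //; rewrite -rhit_comp.
have Ed : E d.
  apply: sub_lspan; exists counit => //; exists counit => //.
  by rewrite lhit_counit rhit_counit.
have [s sd] := lhit_finite d.
have [r rs] := choice rhit_finite.
exists (flatten [seq r x | x <- s]).
apply: subset_trans (simple_subcoalgebra_sub simD cE _) _; first by exists d.
apply: lspan_min => [|_ [f _ [g _ <-]]]; first exact: lspan_subspace.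
have sub := lspan_subspace [set` flatten [seq r x | x <- s]].
apply: (lspan_min (subspace_preim (rhit f) sub)) (sd g) => x xs.
apply: lspan_min (rs x f) => // y yr; apply: sub_lspan.
by apply/flatten_mapP; exists x.
Qed.

(** Acting by [g] is the identity on [D] and kills [A] if [A] is a subcoalgebra: [g]
    then projects [D + A] to [D]. *)
Lemma counit_cutoff D A : simple_subcoalgebra D -> subspace A ->
    (forall x, A x -> D x -> x = 0) ->
  exists2 g : {linear C -> k^o}, (forall x, D x -> g x = counit x) &
    (forall x, A x -> g x = 0).
Proof.
move=> simD sA AD0; have [s Ds] := simple_finite simD.
have [[sD _] _ _] := simD.
have [n [e [f [_ _ fA fK]]]] := dual_basis sA sD AD0 Ds.
have [|g gE] := @linear_functional k C (fun x => \sum_i f i x * (counit (e i) : k)).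
  move=> a x y /=; rewrite scaler_sumr -big_split; apply: eq_bigr => i _ /=.
  by rewrite functionalP mulrDl -mulrA.
exists g => x.
  move=> Dx; rewrite gE {2}(fK x Dx) linear_sum; apply: eq_bigr => i _.
  by rewrite functionalZ.
by move=> Ax; rewrite gE big1 // => i _; rewrite fA // mul0r.
Qed.

(** If [D] meets [A] trivially and [D] meets [E + A], then [D] is contained in
    [E + A] by simplicity.  The projection that is the identity on [D] and kills
    [A] maps [E] to itself, so it shows that [D] is contained in [E]. *)
Lemma simple_disjoint_add D E A : simple_subcoalgebra D -> simple_subcoalgebra E ->
    D <> E -> subcoalgebra A -> (forall x, A x -> D x -> x = 0) ->
  forall a x, A a -> E x -> D (x + a) -> x + a = 0.
Proof.
move=> simD simE DE cA AD0 a x Aa Ex Dxa; apply: contrapT => xa0.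
have [[cD _ _] [cE _ _]] := (simD, simE); have [sA _] := cA.
have subDEA := simple_subcoalgebra_sub simD (subcoalgebraD cE cA).
have {}subDEA : D `<=` [set x + y | x in E & y in A].
  by apply: subDEA; exists (x + a) => //; split=> //; exists x => //; exists a.
have [g gD gA] := counit_cutoff simD sA AD0.
apply: DE; apply: simple_subcoalgebra_eq => // d Dd.
have [e Ee [b Ab eb]] := subDEA _ Dd.
have /subcoalgebraP[_ El _] := cE.
have -> : d = lhit g e.
  rewrite -[LHS]lhit_counit -(lhit_local cD gD Dd) -eb linearD.
  rewrite (lhit_local (g := \0) cA gA Ab).
  have -> : lhit \0 b = 0 :> C.
    by apply: eq_functionals => h; rewrite lhit_rhit linear0.
  by rewrite addr0.
exact: El.
Qed.

(** Finite sums of members of a family, built one summand at a time so that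
    properties of sums of simple subcoalgebras can be proved by induction. *)
Inductive finite_sum (P : set (set C)) : set C -> Prop :=
| FiniteSum0 : finite_sum P [set 0]
| FiniteSumD E A : P E -> finite_sum P A ->
    finite_sum P [set x + y | x in E & y in A].

Lemma subcoalgebra_finite_sum (P : set (set C)) A :
  (forall E, P E -> subcoalgebra E) -> finite_sum P A -> subcoalgebra A.
Proof.
move=> cP; elim=> [|E B PE _ cB]; last exact: subcoalgebraD (cP _ PE) cB.
apply/subcoalgebraP; split; first exact: subspace_set0.
  by move=> f _ ->; rewrite linear0.
by move=> f _ ->; rewrite linear0.
Qed.

Lemma lspan_finite_sum (P : set (set C)) x : (forall E, P E -> subspace E) ->
  lspan (\bigcup_(E in P) E) x -> exists2 A, finite_sum P A & A x.
Proof.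
move=> sP [n [a [v [vP ->]]]]; elim: n a v vP => [|n IHn] a v vP.
  by exists [set 0]; [exact: FiniteSum0 | rewrite big_ord0].
have [A PA Ax] := IHn (fun i => a (lift ord0 i)) _ (fun i => vP (lift ord0 i)).
have [E PE Ev] := vP ord0.
exists [set x + y | x in E & y in A]; first exact: FiniteSumD.
rewrite big_ord_recl; exists (a ord0 *: v ord0).
  exact: subspaceZ (sP _ PE) _ _ Ev.
by exists (\sum_(i < n) a (lift ord0 i) *: v (lift ord0 i)).
Qed.

Definition others D := [set E | simple_subcoalgebra E /\ E <> D].

Lemma simple_others_disjoint D : simple_subcoalgebra D ->
  forall x, lspan (\bigcup_(E in others D) E) x -> D x -> x = 0.
Proof.
move=> simD x Ox.
have cO E : others D E -> subcoalgebra E by case=> -[].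
have [E /cO[]//|A sumA Ax] := lspan_finite_sum _ Ox.
elim: sumA x Ax {Ox} => [//|E B [simE ED] sumB IHB] _ [x Ex [b Bb <-]].
apply: (@simple_disjoint_add D E B) => //; first by move=> DE; apply: ED.
exact: subcoalgebra_finite_sum sumB.
Qed.

Lemma finite_sum_others D A : finite_sum (@simple_subcoalgebra k C) A ->
  (forall x, D x -> A x -> x = 0) -> A `<=` lspan (\bigcup_(E in others D) E).
Proof.
have cS E : simple_subcoalgebra E -> subcoalgebra E by case.
have sO := lspan_subspace (\bigcup_(E in others D) E).
elim=> [_ _ ->|E B simE sumB IHB disj _ [e Ee [b Bb <-]]]; first exact: subspace0.
have [sB _] := subcoalgebra_finite_sum cS sumB.
have [[sE _] _ _] := simE.
apply: subspaceD => //; last first.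
  apply: IHB Bb => x Dx Bx; apply: disj => //.
  by exists 0; [exact: subspace0 | exists x; rewrite ?add0r].
apply: sub_lspan; exists E => //; split=> // ED.
have [x Ex x0] := simple_neq0 simE; apply: x0; apply: disj; first by rewrite -ED.
by exists x => //; exists 0; [exact: subspace0 | rewrite addr0].
Qed.

(** The summands of a finite sum of simple subcoalgebras are added one at a time.
    A new summand [D] is either contained in the sum already formed, and can be
    skipped, or meets it trivially, and then the sum already formed only involves
    simple subcoalgebras other than [D]. *)
Lemma simple_component y : coradical y -> y <> 0 ->
  exists D d a, [/\ simple_subcoalgebra D, D d, d <> 0,
    lspan (\bigcup_(E in others D) E) a & y = d + a].
Proof.
move=> coy; have [E [[]]//|A sumA Ay] := lspan_finite_sum _ coy.
have cS E : simple_subcoalgebra E -> subcoalgebra E by case.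
elim: sumA y Ay {coy} => [//|D A' simD sumA IH] _ [d Dd [a Aa <-]] y0.
have cA := subcoalgebra_finite_sum cS sumA.
have [sA _] := cA.
have [DA|DA0] := pselect (D `<=` A').
  by apply: IH => //; apply: subspaceD => //; apply: DA.
have [d0|d0] := pselect (d = 0).
  by rewrite d0 add0r in y0 *; apply: IH.
exists D, d, a; split=> //.
have DA' x : D x -> A' x -> x = 0.
  move=> Dx Ax; apply: contrapT => x0; apply: DA0.
  by apply: simple_subcoalgebra_sub => //; exists x.
exact: (finite_sum_others sumA DA').
Qed.

End SimpleSubcoalgebras.

(** * From a finite filtration to a finite rank functional *)

Section FiniteFiltration.
Variables (k : fieldType) (C : coalgType k).
Implicit Types (F G f : {linear C -> k^o}) (x : C).
Local Notation filtration := (@coradical_filtration k C).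

(** This is the statement that the product [G * f] of a functional vanishing on
    [H_j] and a functional vanishing on [H_0] vanishes on [H_j.+1]. *)
Lemma coradical_filtration_lhit j G f : (forall x, filtration j x -> G x = 0) ->
    (forall x, coradical x -> f x = 0) ->
  forall x, filtration j.+1 x -> G (lhit f x) = 0.
Proof.
move=> Gj f0 x [s js [t t0 stx]].
rewrite -[lhit f x]/(contractr f (comul x)) -stx !linearD.
have h0 (D E : set C) : (forall x y, D x -> E y -> G x = 0 \/ f y = 0) ->
    forall r, tensor_set D E r -> G (contractr f r) = 0.
  move=> GfDE r; apply: (tensor_set_ker (h := G \o contractr f)) => u v Du Ev /=.
  rewrite contractrE functionalZ.
  by have [->|->] := GfDE _ _ Du Ev; rewrite ?mulr0 ?mul0r.
rewrite (h0 _ _ _ _ js) ?(h0 _ _ _ _ t0) ?addr0 // => u v Du Ev.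
  by right; apply: f0.
by left; apply: Gj.
Qed.

(** If the values of [lhit F] do not all lie in the coradical, some [f] vanishing on
    the coradical has a nonzero product [f \o lhit F] with [F].  Starting from the
    counit this can be repeated, but a product of more than [n] functionals
    vanishing on the coradical is zero when the filtration stops at [n]. *)
Lemma coradical_valued_functional n (x0 : C) : x0 <> 0 -> filtration n = setT ->
  exists2 F : {linear C -> k^o}, ~ (F =1 \0) & forall x, coradical (lhit F x).
Proof.
move=> x00 Hn; apply: contrapT => noF.
(* Products of [m] functionals vanishing on the coradical have this property;
   it passes from [F] to [f * F] because [G * (f * F) = (G * f) * F]. *)
pose shifts m (F : {linear C -> k^o}) := forall j (G : {linear C -> k^o}),
    (forall x, filtration j x -> G x = 0) ->
  forall x, filtration (j + m)%N x -> G (lhit F x) = 0.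
have next (F : {linear C -> k^o}) : ~ (F =1 \0) -> exists (f : {linear C -> k^o}) x,
    (forall y, coradical y -> f y = 0) /\ f (lhit F x) = 1.
  move=> F0; have [x nx] : exists x, ~ coradical (lhit F x).
    by apply: contrapT => allF; apply: noF; exists F => // x; apply: contrapT => nx;
      apply: allF; exists x.
  by have [f f0 fx] := separation (lspan_subspace _) nx; exists f, x.
have shift m : exists2 F : {linear C -> k^o}, ~ (F =1 \0) & shifts m F.
  elim: m => [|m [F F0 Fm]].
    exists counit => [e0|j G Gj x]; last by rewrite addn0 lhit_counit; apply: Gj.
    apply: x00; rewrite -[x0]lhit_counit; apply: eq_functionals => h.
    by rewrite lhit_rhit linear0; apply: e0.
  have [f [x [f0 fx]]] := next F F0.
  exists (f \o lhit F) => [/(_ x) /= /eqP|j G Gj y].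
    by rewrite -[contractr F _]/(lhit F x) fx oner_eq0.
  rewrite addnS -addSn -lhit_comp.
  exact: (Fm _ (G \o lhit f) (coradical_filtration_lhit Gj f0)).
have [F F0 Fn] := shift n; have [f [x [f0 fx]]] := next F F0.
have : f (lhit F x) = 0 by apply: (Fn 0%N); rewrite ?add0n ?Hn.
by rewrite fx => /eqP; rewrite oner_eq0.
Qed.

(** The functional is the convolution of [F] with the projection [g] to a simple
    component [D] of one of the values of [lhit F]. *)
Lemma finite_rank_functional F x : (forall x, coradical (lhit F x)) -> F x <> 0 ->
  exists (F' : {linear C -> k^o}) (s : seq C),
  ~ (F' =1 \0) /\ forall x, lspan [set` s] (lhit F' x).
Proof.
move=> coF Fx.
have y0 : lhit F x <> 0.
  by move=> y0; apply: Fx; rewrite -[x]rhit_counit -lhit_rhit y0 linear0.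
have [D [d [a [simD Dd d0 Oa ya]]]] := simple_component (coF x) y0.
have [cD _ _] := simD.
have [s Ds] := simple_finite simD.
have cO E : others D E -> subcoalgebra E by case=> -[].
have cOD := subcoalgebra_lspan cO; have [sO _] := cOD.
have [g gD gO] := counit_cutoff simD sO (simple_others_disjoint simD).
have gd z : D z -> lhit g z = z.
  by move=> Dz; rewrite -[RHS]lhit_counit; apply: (lhit_local cD gD).
have go z : lspan (\bigcup_(E in others D) E) z -> lhit g z = 0.
  move=> Oz; rewrite (lhit_local (g := \0) cOD gO Oz).
  by apply: eq_functionals => h; rewrite lhit_rhit linear0.
exists (g \o lhit F), s; split=> [gF0|z].
  have dE : d = lhit g (lhit F x) by rewrite ya linearD gd // go // addr0.
  apply: d0; rewrite dE lhit_comp; apply: eq_functionals => h.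
  by rewrite lhit_rhit linear0; apply: gF0.
rewrite -lhit_comp; have sD := subspace_preim (lhit g) (proj1 cD).
apply: Ds; apply: (lspan_min sD) (coF z) => w [E simE Ew]; rewrite /preimage /=.
rewrite -[contractr _ _]/(lhit g w).
have [ED|ED] := pselect (E = D); first by rewrite gd -ED.
rewrite go; first exact: subspace0 (proj1 cD).
by apply: sub_lspan; exists E.
Qed.

End FiniteFiltration.


(** * Comatrices and integrals *)

Section Comatrix.
Variables (k : fieldType) (H : hopfAlgType k).

Lemma contractr_suml (U V : lmodType k) (I : Type) (r : seq I)
    (F : I -> {linear V -> k^o}) (f : {linear V -> k^o}) (t : tensor U V) :
  (forall v, f v = \sum_(i <- r) F i v) ->
  contractr f t = \sum_(i <- r) contractr (F i) t.
Proof.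
move=> fE; elim/tensor_ind: t => [|u v t IHt].
  by rewrite linear0 big1 // => i _; rewrite linear0.
rewrite linearD IHt contractrE fE scaler_suml -big_split; apply: eq_bigr => i _ /=.
by rewrite linearD contractrE.
Qed.

Lemma tensM (a b a' b' : H) : (a \ox b) * (a' \ox b') = (a * a') \ox (b * b').
Proof. exact: tensor_mulE. Qed.

(** The matrix coefficients of a left comodule of dimension [n] in a basis. *)
Definition comatrix n (c : 'M[H]_n) : Prop :=
  (forall i j, comul (c i j) = \sum_l c i l \ox c l j) /\
  (forall i j, counit (c i j) = (i == j)%:R).

Lemma antipode_mul_comatrix n (c : 'M[H]_n) : comatrix c ->
  map_mx antipode c *m c = 1%:M.
Proof.
case=> Dc ec; apply/matrixP => i j; rewrite !mxE.
transitivity ((counit (c i j) : k) *: (1 : H)); last first.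
  by rewrite ec; case: eqP => _; rewrite ?scale1r // scale0r.
rewrite -antipodel Dc !linear_sum; apply: eq_bigr => l _.
by rewrite /= tensor_mapE mulTE mxE.
Qed.

Lemma comatrix_mul_antipode n (c : 'M[H]_n) : comatrix c ->
  c *m map_mx antipode c = 1%:M.
Proof.
case=> Dc ec; apply/matrixP => i j; rewrite !mxE.
transitivity ((counit (c i j) : k) *: (1 : H)); last first.
  by rewrite ec; case: eqP => _; rewrite ?scale1r // scale0r.
rewrite -antipoder Dc !linear_sum; apply: eq_bigr => l _.
by rewrite /= tensor_mapE mulTE mxE.
Qed.

(** The matrix [S(c)] is the inverse of [c].  Its image under the comultiplication is
    therefore the inverse of [(c (x) 1) (1 (x) c)], namely
    [(1 (x) S(c)) (S(c) (x) 1)].  The factors come in the opposite order, so it is the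
    transpose that is a comatrix. *)
Lemma comatrix_antipode n (c : 'M[H]_n) : comatrix c -> comatrix (map_mx antipode c)^T.
Proof.
move=> cc; have [Dc ec] := cc; set y := map_mx antipode c.
have yc : y *m c = 1%:M := antipode_mul_comatrix cc.
have cy : c *m y = 1%:M := comatrix_mul_antipode cc.
have [comul1 comulM] := @comul_monoid_morphism k H.
have [counit1 counitM] := @counit_monoid_morphism k H.
pose inl (x : H) : tensor H H := x \ox 1.
pose inr (x : H) : tensor H H := 1 \ox x.
pose D (x : H) : tensor H H := comul x.
have mapM (f : H -> tensor H H) : (forall a b, f (a * b) = f a * f b) ->
    (forall F : 'I_n -> H, f (\sum_i F i) = \sum_i f (F i)) ->
    forall a b : 'M[H]_n, map_mx f (a *m b) = map_mx f a *m map_mx f b.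
  move=> fM fS a b; apply/matrixP => i j; rewrite !mxE fS; apply: eq_bigr => l _.
  by rewrite !mxE fM.
have map1 (f : H -> tensor H H) : f 1 = 1 -> f 0 = 0 ->
    map_mx f (1%:M : 'M[H]_n) = 1%:M.
  by move=> f1 f0; apply/matrixP => i j; rewrite !mxE; case: eqP.
have Dyc : map_mx D y *m map_mx D c = 1%:M.
  rewrite -mapM ?yc ?map1 //; [exact: linear0 | move=> F; exact: linear_sum].
have inlcy : map_mx inl c *m map_mx inl y = 1%:M.
  rewrite -mapM ?cy ?map1 //; first exact: linear0l.
    by move=> a b; rewrite tensM mulr1.
  by move=> F; rewrite /inl tens_suml.
have inrcy : map_mx inr c *m map_mx inr y = 1%:M.
  rewrite -mapM ?cy ?map1 //; first exact: linear0r.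
    by move=> a b; rewrite tensM mulr1.
  by move=> F; rewrite /inr tens_sumr.
have Dc2 : map_mx D c = map_mx inl c *m map_mx inr c.
  apply/matrixP => i j; rewrite !mxE [LHS]Dc; apply: eq_bigr => l _.
  by rewrite !mxE tensM mulr1 mul1r.
have Dy : map_mx D y = map_mx inr y *m map_mx inl y.
  rewrite -[RHS]mul1mx -Dyc Dc2 -!mulmxA (mulmxA (map_mx inr c)) inrcy mul1mx.
  by rewrite inlcy mulmx1.
split=> i j.
  have /matrixP/(_ j i) := Dy; rewrite !mxE /D => ->; apply: eq_bigr => l _.
  by rewrite !mxE tensM mulr1 mul1r.
have /matrixP/(_ j i) := yc; rewrite !mxE => /(congr1 counit).
rewrite linear_sum (bigD1 i) //= counitM ec eqxx mulr1 big1 => [|l li]; last first.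
  by rewrite counitM ec (negPf li) mulr0.
rewrite addr0 mxE => ->; rewrite eq_sym; case: eqP => _; first exact: counit1.
exact: linear0.
Qed.

Definition rmul (z : H) : {linear H -> H} := applyr (@Defs.mul_fun k H) z.

Lemma contractr_rmul (f : {linear H -> k^o}) (t : tensor H H) a b :
  contractr f (t * (a \ox b)) = contractr (f \o rmul b) t * a.
Proof.
elim/tensor_ind: t => [|u v t IHt]; first by rewrite mul0r !linear0 mul0r.
by rewrite mulrDl !linearD mulrDl IHt tensM !contractrE scalerAl.
Qed.

(** The hypothesis [phic] says that [h |-> sum_i phi_i(h) e_i] is a morphism of left
    comodules from [H] to the comodule with basis [e_i] and coefficients [c]. *)
Section IntegralOfComatrix.
Variables (n : nat) (c : 'M[H]_n) (phi : 'I_n -> {linear H -> k^o}).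
Hypothesis cc : comatrix c.
Hypothesis phic : forall j h, lhit (phi j) h = \sum_i (phi i h : k) *: c i j.

Let y := map_mx antipode c.
Let z := map_mx antipode y.

Lemma comatrix_antipode2 : comatrix z.
Proof.
have := comatrix_antipode (comatrix_antipode cc).
by congr comatrix; apply/matrixP => i j; rewrite !mxE.
Qed.

(** The transposes matter: in a noncommutative algebra [z], whose entries are the
    [S(S(c_ij))], need not be the inverse of [y], but the transpose of [z] is the
    inverse of the transpose of [y]. *)
Lemma antipode2_inv l m : \sum_i z i l * y m i = (l == m)%:R.
Proof.
have /matrixP/(_ l m) := antipode_mul_comatrix (comatrix_antipode cc).
by rewrite !mxE => <-; apply: eq_bigr => i _; rewrite !mxE.
Qed.

Lemma antipode2_invr l i : \sum_j y j l * z i j = (l == i)%:R.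
Proof.
have /matrixP/(_ l i) := comatrix_mul_antipode (comatrix_antipode cc).
by rewrite !mxE => <-; apply: eq_bigr => j _; rewrite !mxE.
Qed.

Lemma comatrix_mul_antipode_coef p i : \sum_m c p m * y m i = (p == i)%:R.
Proof.
have /matrixP/(_ p i) := comatrix_mul_antipode cc.
by rewrite !mxE.
Qed.

(** The inverse of the transpose of [y] allows to insert [sum_i z_il y_mi], so that
    [t ~> h] is expressed by the elements [phi_m ~> (h z_ij)].  These are known by
    [phic], and what remains is contracted with [c y = 1]. *)
Lemma comatrix_integral (j : 'I_n) : exists2 t : {linear H -> k^o},
  (forall h, t h = \sum_i phi i (h * z i j)) & forall h, lhit t h = (t h : k) *: 1.
Proof.
have [|t tE] := @linear_functional _ H (fun h => \sum_i phi i (h * z i j)).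
  move=> a u v /=; rewrite scaler_sumr -big_split; apply: eq_bigr => i _ /=.
  by rewrite mulrDl -scalerAl linearP.
exists t => // h.
(* [lhit t h] is the trace of [X], and multiplying [X] by [z] gives the elements
   [lhit (phi m) (h * z i j)]. *)
pose X m l := contractr (phi m \o rmul (z l j)) (comul h).
have XE m i : \sum_l X m l * z i l = \sum_p (phi p (h * z i j) : k) *: c p m.
  rewrite -phic /= (@comul_monoid_morphism k H).2 (proj1 comatrix_antipode2).
  by rewrite mulr_sumr linear_sum; apply: eq_bigr => l _; rewrite contractr_rmul.
have -> : lhit t h = \sum_l X l l by apply: contractr_suml => v; rewrite tE.
transitivity (\sum_i \sum_m (\sum_l X m l * z i l) * y m i).
  transitivity (\sum_l \sum_m X m l * (l == m)%:R).
    apply: eq_bigr => l _; rewrite (bigD1 l) //= eqxx mulr1 big1 ?addr0 // => m ml.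
    by rewrite eq_sym (negPf ml) mulr0.
  under eq_bigr do under eq_bigr do rewrite -antipode2_inv mulr_sumr.
  under [RHS]eq_bigr do under eq_bigr do rewrite mulr_suml.
  rewrite exchange_big /= [RHS]exchange_big; apply: eq_bigr => m _ /=.
  rewrite exchange_big; apply: eq_bigr => i _ /=; apply: eq_bigr => l _.
  by rewrite mulrA.
transitivity (\sum_i \sum_p (phi p (h * z i j) : k) *: ((p == i)%:R : H)).
  apply: eq_bigr => i _; under eq_bigr do rewrite XE mulr_suml.
  rewrite exchange_big; apply: eq_bigr => p _ /=.
  rewrite -comatrix_mul_antipode_coef scaler_sumr.
  by apply: eq_bigr => m _; rewrite scalerAl.
rewrite tE scaler_suml; apply: eq_bigr => i _.
rewrite (bigD1 i) //= eqxx big1 ?addr0 // => p pi.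
by rewrite (negPf pi) scaler0.
Qed.

(** Since [sum_j y_jl z_ij] is 1 for [i = l] and 0 otherwise, [phi_l(h)] is the sum
    over [j] of the values at [h y_jl] of the integrals [comatrix_integral j]. *)
Lemma comatrix_integral_neq0 (l : 'I_n) : ~ (phi l =1 \0) ->
  exists2 t : {linear H -> k^o},
    (forall h, lhit t h = (t h : k) *: 1) & ~ (t =1 \0).
Proof.
move=> phi0; apply: contrapT => not0; apply: phi0 => h.
have vanish j h' : \sum_i phi i (h' * z i j) = 0.
  have [t tE tI] := comatrix_integral j; rewrite -tE.
  by apply: contrapT => t0; apply: not0; exists t => // /(_ h').
transitivity (\sum_i phi i (h * (l == i)%:R)).
  rewrite (bigD1 l) //= eqxx mulr1 big1 ?addr0 // => i il.
  by rewrite eq_sym (negPf il) mulr0 linear0.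
under eq_bigr do rewrite -antipode2_invr mulr_sumr linear_sum.
rewrite exchange_big big1 // => j _ /=.
by under eq_bigr do rewrite mulrA; rewrite vanish.
Qed.

End IntegralOfComatrix.

End Comatrix.

(** * From a finite rank functional to an integral *)

Section FiniteRank.
Variables (k : fieldType) (H : hopfAlgType k).

(** This turns the condition defining a left integral [t] into [lhit t h = t h *: 1]. *)
Lemma convolutionE (f g : {linear H -> k^o}) x : convolution f g x = f (lhit g x).
Proof.
rewrite -[LHS]/(mulT k^o (tensor_map f g (comul x))).
rewrite -[lhit g x]/(contractr g (comul x)).
elim/tensor_ind: (comul x) => [|u v t IHt].
  by rewrite !linear0.
by rewrite !linearD IHt tensor_mapE mulTE contractrE functionalZ mulrC.
Qed.

(** A biorthogonal basis [e], [f] of the image of [lhit F] gives the coordinates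
    [phi_i = f_i \o lhit F] of the comodule morphism [lhit F] and the matrix
    coefficients [c_ij = lhit f_j e_i] of its image. *)
Lemma finite_rank_co_Frobenius (F : {linear H -> k^o}) (s : seq H) :
  ~ (F =1 \0) -> (forall x, lspan [set` s] (lhit F x)) -> co_Frobenius H.
Proof.
move=> F0 Fs.
pose S := range (lhit F).
have sS : subspace S.
  apply/subspaceP; split; first by exists 0; rewrite ?linear0.
  by move=> a _ _ [u _ <-] [v _ <-]; exists (a *: u + v); rewrite ?linearP.
have Ss : S `<=` lspan [set` s] by move=> _ [x _ <-].
have [n [e [f [Se fe _ fK]]]] := dual_basis (subspace_set0 _) sS (fun x x0 _ => x0) Ss.
pose phi i : {linear H -> k^o} := f i \o lhit F.
have lhitF x : lhit F x = \sum_i (phi i x : k) *: e i by apply: fK; exists x.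
pose c : 'M[H]_n := \matrix_(i, j) lhit (f j) (e i).
have phic j h : lhit (phi j) h = \sum_i (phi i h : k) *: c i j.
  rewrite -lhit_comp lhitF linear_sum; apply: eq_bigr => i _.
  by rewrite linearZ mxE.
have cc : comatrix c.
  split=> i j; rewrite !mxE; last by rewrite lhit_rhit rhit_counit fe eq_sym.
  have [x _ ex] := Se i.
  have De : comul (e i) = \sum_l c i l \ox e l.
    rewrite -{1}ex comul_lhit (tensor_map_coord _ lhitF); apply: eq_bigr => l _.
    rewrite -[contractr _ _]/(lhit (phi l) x) phic.
    have phix m : phi m x = (m == i)%:R by rewrite -fe -ex.
    under eq_bigr do rewrite phix.
    rewrite (bigD1 i) //= eqxx scale1r big1 ?addr0 // => m mi.
    by rewrite (negPf mi) scale0r.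
  rewrite comul_lhit De linear_sum; apply: eq_bigr => l _.
  by rewrite tensor_mapE !mxE.
have [l phi0] : exists l, ~ (phi l =1 \0).
  apply: contrapT => nophi; apply: F0 => x.
  have -> : F x = counit (lhit F x) by rewrite lhit_rhit rhit_counit.
  rewrite lhitF linear_sum big1 // => i _; rewrite functionalZ.
  rewrite (_ : phi i x = 0) ?mul0r //.
  by apply: contrapT => phix; apply: nophi; exists i => /(_ x).
have [t tI t0] := comatrix_integral_neq0 cc phic phi0.
by exists t => // g x; rewrite convolutionE tI functionalZ mulrC.
Qed.

End FiniteRank.

(** * Finite coradical filtration *)

Theorem corollary1p3 (k : fieldType) (H : hopfAlgType k) :
  (exists n : nat, @coradical_filtration k H n = @setT H) -> co_Frobenius H.
Proof.
have one0 : 1 <> 0 :> H by apply/eqP; rewrite oner_eq0.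
move=> [n Hn]; have [F F0 coF] := coradical_valued_functional one0 Hn.
have [x Fx] : exists x, F x <> 0.
  by apply: contrapT => Fx; apply: F0 => x; apply: contrapT => Fx0; apply: Fx; exists x.
have [F' [s [F'0 F's]]] := finite_rank_functional coF Fx.
exact: finite_rank_co_Frobenius F'0 F's.
Qed.
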